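(* Let $L \in \mathbb{R}^{n\times n}$ be symmetric positive definite, let $K := L^{-1}$, let $\mathcal{I} \subset \{1,\dots,n\}$ be nonempty, and let $t>0$. Put $P(t) := e^{-Lt}$, $V := \mathrm{orth}(K_{:,\mathcal{I}}) = K_{:,\mathcal{I}}\,\big((K^2)_{\mathcal{I},\mathcal{I}}\big)^{-1/2}$, and $P_{\mathcal{I}}(t) := V e^{-(V^\top L V)t} V^\top$. Define $$\varepsilon_2(\mathcal{I}) := \|K - K_{:,\mathcal{I}} K_{\mathcal{I},\mathcal{I}}^{-1} K_{\mathcal{I},:}\|_2, \qquad \varepsilon_*(\mathcal{I}) := \|K - K_{:,\mathcal{I}} K_{\mathcal{I},\mathcal{I}}^{-1} K_{\mathcal{I},:}\|_* .$$ Then $$\|P(t) - P_{\mathcal{I}}(t)\|_2 \le \frac{3\sqrt{3}}{2\pi}\,\frac{\varepsilon_2(\mathcal{I})}{t} \qquad\text{and}\qquad \|P(t) - P_{\mathcal{I}}(t)\|_* \le \frac{3\sqrt{3}}{2\pi}\,\frac{\varepsilon_*(\mathcal{I})}{t}.$$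
   Context: $\|\cdot\|_2$ is the spectral norm (largest singular value) and $\|\cdot\|_*$ the nuclear norm (sum of singular values). $K_{:,\mathcal{I}}$ denotes the submatrix of columns indexed by $\mathcal{I}$, $K_{\mathcal{I},:}$ the rows indexed by $\mathcal{I}$, $K_{\mathcal{I},\mathcal{I}}$ the principal submatrix. For a matrix $A$ of full column rank, $\mathrm{orth}(A) := A(A^\top A)^{-1/2}$. *)

(* Defs.v *)
From mathcomp Require Import all_boot all_order all_algebra.
From mathcomp Require polyrcf.
From mathcomp Require Import all_classical all_reals all_analysis.
Set Implicit Arguments.
Unset Strict Implicit.
Unset Printing Implicit Defensive.
Import Order.TTheory GRing.Theory Num.Theory.
Import numFieldNormedType.Exports.
Local Open Scope classical_set_scope.
Local Open Scope ring_scope.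

Definition posdefmx (R : realType) (n : nat) (A : 'M[R]_n) : Prop :=
  A^T = A /\ forall x : 'cV[R]_n, x != 0 -> 0 < (x^T *m A *m x) 0 0.

Definition expmx (R : realType) (n : nat) (A : 'M[R]_n) : 'M[R]_n :=
  limn (series (fun k : nat => (k`!%:R)^-1 *: A ^+ k)).

(* For symmetric positive definite A this is the unique symmetric positive
   definite B with B ^ 2 = A ^ -1; the default value 0 is only used when no
   such B exists. *)
Definition invsqrtmx (R : realType) (n : nat) (A : 'M[R]_n) : 'M[R]_n :=
  xget 0 [set B : 'M[R]_n | posdefmx B /\ B *m B = invmx A].

Definition orthmx (R : realType) (m n : nat) (A : 'M[R]_(m, n)) : 'M[R]_(m, n) :=
  A *m invsqrtmx (A^T *m A).

(* Square roots of the eigenvalues of A^T A, repeated according to their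
   algebraic multiplicity as roots of the characteristic polynomial. When
   n > m, the list has n - m more zeros than min(m, n) singular values, which
   affects neither the maximum nor the sum. *)
Definition singular_values (R : realType) (m n : nat) (A : 'M[R]_(m, n)) :
    seq R :=
  let p := char_poly (A^T *m A) in
  flatten [seq nseq (mup x p) (Num.sqrt x) | x <- polyrcf.rootsR p].

Definition spectral_norm (R : realType) (m n : nat) (A : 'M[R]_(m, n)) : R :=
  \big[Num.max/0]_(s <- singular_values A) s.

Definition nuclear_norm (R : realType) (m n : nat) (A : 'M[R]_(m, n)) : R :=
  \sum_(s <- singular_values A) s.

(* A_{:,I}, A_{I,:} and A_{I,I}, the indices of I being enumerated by
   enum_val. *)
Definition cols_of (R : realType) (m n : nat) (I : {set 'I_n})
    (A : 'M[R]_(m, n)) : 'M[R]_(m, #|I|) :=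
  colsub (fun k : 'I_#|I| => enum_val k) A.

Definition rows_of (R : realType) (m n : nat) (I : {set 'I_m})
    (A : 'M[R]_(m, n)) : 'M[R]_(#|I|, n) :=
  rowsub (fun k : 'I_#|I| => enum_val k) A.

Definition principal_submx (R : realType) (n : nat) (I : {set 'I_n})
    (A : 'M[R]_n) : 'M[R]_#|I| :=
  mxsub (fun k : 'I_#|I| => enum_val k) (fun k : 'I_#|I| => enum_val k) A.

Lemma orthmx_cols_of (R : realType) (n : nat) (I : {set 'I_n}) (K : 'M[R]_n) :
  K^T = K ->
  orthmx (cols_of I K)
    = cols_of I K *m invsqrtmx (principal_submx I (K *m K)).
Proof.
move=> sK; rewrite /orthmx; congr (_ *m invsqrtmx _).
apply/matrixP => i j; rewrite !mxE; apply: eq_bigr => k _.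
by rewrite !mxE; congr (_ * _); rewrite -[in RHS]sK mxE.
Qed.

(* K - K_{:,I} K_{I,I}^{-1} K_{I,:} *)
Definition nystrom_residual (R : realType) (n : nat) (I : {set 'I_n})
    (K : 'M[R]_n) : 'M[R]_n :=
  K - cols_of I K *m invmx (principal_submx I K) *m rows_of I K.

(* Main.v *)
Require Import Defs.
From mathcomp Require Import all_boot all_order all_algebra.
From mathcomp Require Import ring lra complex.
From mathcomp Require Import all_classical all_reals all_analysis.
Set Implicit Arguments.
Unset Strict Implicit.
Unset Printing Implicit Defensive.
Import Order.TTheory GRing.Theory Num.Theory.
Import numFieldNormedType.Exports.
Local Open Scope ring_scope.

(** Put G = V (V^T L V)^-1 V^T. The residual is E = K - G, and with
f(x) = exp(-t/x), f(0) = 0, one has P(t) = f(K) and P_I(t) = f(G). In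
eigenbases of K and G the matrix f(K) - f(G) is therefore the entrywise product
of E with the divided differences of f, and it suffices to bound the norm of
this Schur multiplier by 3 sqrt 3 / (2 pi t). Instead of representing it by a
contour integral, take t = 1, a = 1/mu, b = 1/nu and write it as
  phi(a) chi(b) + chi(a) phi(b) + int_0^1 g_s(a) g_(1-s)(b) ds
with phi(a) = a e^-a, chi(a) = 1 - e^-a - phi(a)/2 and
g_s(a) = a (e^(-(1-s)a) - e^-a). The first two terms together have multiplier
norm at most max (9/4 phi^2 + 4/9 chi^2) <= 0.46. As g_s <= 0.59 s / (1 - s),
the integrand has multiplier norm at most 0.59^2 for every s. The sum 0.8081 is
below 3 sqrt 3 / (2 pi). A Schur multiplier bound for the spectral norm gives
the same bound for the nuclear norm by trace duality. *)

(** * Explicit scalar inequalities *)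

Lemma ge0_derive_le (R : realType) (f df : R -> R) (a b : R) :
  a <= b -> (forall x : R, is_derive x 1 f (df x)) ->
  (forall x, a < x < b -> 0 <= df x) -> f a <= f b.
Proof.
rewrite le_eqVlt => /predU1P[->//|ab] fdf df0.
have fc : {within `[a, b], continuous f}%classic.
  apply: continuous_subspaceT => x; apply: differentiable_continuous.
  exact/derivable1_diffP.
have [c cab e] := MVT ab (fun x _ => fdf x) fc.
by rewrite -subr_ge0 e mulr_ge0 ?subr_ge0 ?(ltW ab)// df0.
Qed.

Section Scalars.
Variable R : realType.
Implicit Types a b u w x : R.

Lemma sum_exp_coeff_le n x : 0 <= x ->
  \sum_(k < n) (x ^+ k / k`!%:R) <= expR x.
Proof.
move=> x0; rewrite -(big_mkord xpredT (fun k => x ^+ k / k`!%:R)).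
apply: (@nondecreasing_cvgn_le _ (series (exp_coeff x))) => //.
  apply: nondecreasing_series => k _ _; rewrite /exp_coeff.
  by rewrite divr_ge0// exprn_ge0.
exact: is_cvg_series_exp_coeff.
Qed.

Lemma expR_ge_taylor3 x : 0 <= x ->
  1 + x + x ^+ 2 / 2 + x ^+ 3 / 6 <= expR x.
Proof.
move=> x0; apply: le_trans (sum_exp_coeff_le 4 x0).
rewrite !big_ord_recr big_ord0 /= !factS fact0 /=; lra.
Qed.

Lemma expR_ge_taylor5 x : 0 <= x ->
  1 + x + x ^+ 2 / 2 + x ^+ 3 / 6 + x ^+ 4 / 24 + x ^+ 5 / 120 <= expR x.
Proof.
move=> x0; apply: le_trans (sum_exp_coeff_le 6 x0).
rewrite !big_ord_recr big_ord0 /= !factS fact0 /=; lra.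
Qed.

(** This is the Padé bound [(2 - x) / (2 + x) <= expR (- x)] with denominators cleared. The gap [f]
    vanishes at 0 and has nonnegative derivative because [1 + y <= expR y]. *)
Lemma expRN_pade x : 0 <= x -> (2 + x) * (1 - expR (- x)) <= 2 * x.
Proof.
move=> x0.
pose f (y : R) : R := (2 + y) * expR (- y) - (2 - y).
suff : f 0 <= f x.
  rewrite /f oppr0 expR0; lra.
apply: (@ge0_derive_le _ f (fun y => 1 - (1 + y) * expR (- y))) => // y.
  by rewrite /f; apply: is_derive_eq; rewrite /GRing.scale /=; lra.
move=> _; rewrite subr_ge0 expRN ler_pdivrMr ?expR_gt0// mul1r.
exact: expR_ge1Dx.
Qed.

(** Cosine is positive on [[0, pi / 2[], so it suffices that [cos (8 / 5) <= 0]. The cubic Taylor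
    bound for sine at 2/5 is carried to 8/5 by doubling the angle twice. *)
Lemma pi_le_16_5 : pi <= 16 / 5 :> R.
Proof.
have sinle x : 0 <= x -> sin x <= x.
  move=> x0; pose f (y : R) : R := y - sin y.
  suff : f 0 <= f x by rewrite /f sin0; lra.
  apply: (@ge0_derive_le _ f (fun y => 1 - cos y)) => //.
have cosge x : 0 <= x -> 1 - x ^+ 2 / 2 <= cos x.
  move=> x0; pose f (y : R) : R := cos y + y ^+ 2 / 2.
  suff : f 0 <= f x by rewrite /f cos0; lra.
  apply: (@ge0_derive_le _ f (fun y => y - sin y)) => // y.
    by apply: is_derive_eq; rewrite /GRing.scale /=; lra.
  by move=> /andP[y0 _]; rewrite subr_ge0 sinle// ltW.
have singe x : 0 <= x -> x - x ^+ 3 / 6 <= sin x.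
  move=> x0; pose f (y : R) : R := sin y - y + y ^+ 3 / 6.
  suff : f 0 <= f x by rewrite /f sin0; lra.
  apply: (@ge0_derive_le _ f (fun y => cos y - 1 + y ^+ 2 / 2)) => // y.
    by apply: is_derive_eq; rewrite /GRing.scale /=; lra.
  by move=> /andP[y0 _]; have := cosge _ (ltW y0); lra.
have s : 389 / 1000 <= sin (2 / 5 : R).
  by apply: le_trans (singe _ _); lra.
have c0 : cos (4 / 5 : R) <= 698 / 1000.
  have -> : (4 / 5 : R) = (2 / 5) *+ 2 by rewrite mulr2n; lra.
  rewrite cos_mulr2n; have := cos2Dsin2 (2 / 5 : R); nra.
have c1 : 0 <= cos (4 / 5 : R) by apply: le_trans (cosge _ _); lra.
have c2 : cos (8 / 5 : R) <= 0.
  have -> : (8 / 5 : R) = (4 / 5) *+ 2 by rewrite mulr2n; lra.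
  rewrite cos_mulr2n; nra.
rewrite leNgt; apply/negP => h.
have : 0 < cos (8 / 5 : R) by apply: cos_gt0_pihalf; lra.
by rewrite ltNge c2.
Qed.

Lemma sqrt3_pi_ge :
  46 / 100 + (59 / 100) ^+ 2 <= 3 * Num.sqrt 3 / (2 * pi) :> R.
Proof.
rewrite ler_pdivlMr ?mulr_gt0 ?pi_gt0//.
have q0 : 0 <= Num.sqrt (3 : R) by exact: sqrtr_ge0.
have q3 : Num.sqrt (3 : R) ^+ 2 = 3 by rewrite sqr_sqrtr.
(* Here [(19 / 11) ^+ 2 = 361 / 121 < 3]. With [pi <= 16 / 5] the right-hand side is at least
   0.8096, against 0.8081 on the left. *)
have s3 : 19 / 11 <= Num.sqrt (3 : R) by rewrite leNgt; apply/negP => lt3; nra.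
have := pi_le_16_5; lra.
Qed.

(* For q = expR (- a) the right-hand side minus the left-hand side is concave in q
   and positive at q = 0, and q is at most the inverse of the Taylor polynomial T. *)
Lemma weighted_sq_bound a : 0 <= a ->
  9 / 4 * (a * expR (- a)) ^+ 2
    + 4 / 9 * (1 - expR (- a) - a * expR (- a) / 2) ^+ 2 <= 46 / 100.
Proof.
move=> a0.
set T := 1 + a + a ^+ 2 / 2 + a ^+ 3 / 6.
have T0 : 0 <= T by rewrite /T; have := exprn_ge0 2 a0; have := exprn_ge0 3 a0; lra.
set q := expR (- a).
have q0 : 0 <= q by exact: expR_ge0.
have qT : q * T <= 1.
  rewrite /q expRN mulrC ler_pdivrMr ?expR_gt0// mul1r.
  exact: expR_ge_taylor3.
(* The polynomial is [T ^+ 2] times the gap of the goal at [q = 1 / T]. Multiplied by [q ^+ 2], it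
   is carried to the actual [q] by [h1] and [h2], which use [q * T <= 1]. *)
have P : 0 <= 7 / 450 * T ^+ 2 + 8 / 9 * T * (1 + a / 2)
     - 9 / 4 * a ^+ 2 - 4 / 9 * (1 + a / 2) ^+ 2.
  have a4 : 0 <= a ^+ 4 by exact: exprn_ge0.
  have a5 : 0 <= a ^+ 5 by exact: exprn_ge0.
  have a6 : 0 <= a ^+ 6 by exact: exprn_ge0.
  have a3 : 0 <= a * (a - 3 / 2) ^+ 2 by rewrite mulr_ge0// sqr_ge0.
  have a42 : 0 <= (a ^+ 2 - 9 / 4) ^+ 2 by exact: sqr_ge0.
  have a2 : 0 <= (a - 3 / 2) ^+ 2 by exact: sqr_ge0.
  rewrite /T; lra.
have h1 : q * T * (q * T) <= 1 by apply: mulr_ile1; rewrite ?mulr_ge0.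
have h2 : q * T * (q * (1 + a / 2)) <= 1 * (q * (1 + a / 2)).
  by apply: ler_wpM2r => //; rewrite mulr_ge0//; lra.
have := mulr_ge0 (sqr_ge0 q) P.
nra.
Qed.

Lemma expR_linear_bound u : 0 <= u -> u * (1 + u / 2) * expR (- u) <= 59 / 100.
Proof.
move=> u0; rewrite expRN ler_pdivrMr ?expR_gt0//.
have := expR_ge_taylor5 u0.
suff : u * (1 + u / 2) <= 59 / 100 *
  (1 + u + u ^+ 2 / 2 + u ^+ 3 / 6 + u ^+ 4 / 24 + u ^+ 5 / 120) by lra.
(* The function [u * (1 + u / 2) * expR (- u)] peaks at [u = sqrt 2] with value about 0.587, so the
   inequality is tight there. The squares are chosen to vanish at or near that point. *)
have u1 : 0 <= u * (u - 7 / 5) ^+ 2 by rewrite mulr_ge0// sqr_ge0.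
have u2 : 0 <= (u ^+ 2 - 2) ^+ 2 by exact: sqr_ge0.
have u3 : 0 <= (u - 7 / 5) ^+ 2 by exact: sqr_ge0.
have u4 : 0 <= u * (u ^+ 2 - 2) ^+ 2 by rewrite mulr_ge0// sqr_ge0.
nra.
Qed.

Lemma expR_sq_bound u : 2 <= u -> u ^+ 2 * expR (- u) <= 59 / 100.
Proof.
move=> u2; have u0 : 0 <= u by lra.
rewrite expRN ler_pdivrMr ?expR_gt0//.
have := expR_ge_taylor5 u0.
suff : u ^+ 2 <= 59 / 100 *
  (1 + u + u ^+ 2 / 2 + u ^+ 3 / 6 + u ^+ 4 / 24 + u ^+ 5 / 120) by lra.
have v0 : 0 <= u - 2 by lra.
have v2 : 0 <= (u - 2) ^+ 2 by exact: sqr_ge0.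
have v3 : 0 <= (u - 2) ^+ 3 by exact: exprn_ge0.
have v4 : 0 <= (u - 2) ^+ 4 by exact: exprn_ge0.
have v5 : 0 <= (u - 2) ^+ 5 by exact: exprn_ge0.
nra.
Qed.

(** With [z = 1 - expR (- w)], the factor [(u + w) * z] is at most [(1 + u / 2) * w] for [u <= 2],
    by combining the Padé bound with [z <= 1]. For [u > 2] it is at most [u * w], by the Padé bound
    and [z <= w]. Each case leaves a function of [u] alone. *)
Lemma expR_diff_bound u w : 0 <= u -> 0 <= w ->
  u * (u + w) * expR (- u) * (1 - expR (- w)) <= 59 / 100 * w.
Proof.
move=> u0 w0; set z := 1 - expR (- w).
have z0 : 0 <= z by rewrite /z subr_ge0 expR_le1 oppr_le0.
have z1 : z <= 1 by rewrite /z gerBl expR_ge0.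
have zw : z <= w by rewrite /z; have := expR_ge1Dx (- w); lra.
have zp : (2 + w) * z <= 2 * w by exact: expRN_pade.
have q0 : 0 <= expR (- u) by exact: expR_ge0.
have [u2|u2] := leP u 2.
  have h : (u + w) * z <= (1 + u / 2) * w.
    have := ler_wpM2l u0 zp.
    have : 0 <= (2 - u) * (w * (1 - z)) by rewrite !mulr_ge0 ?subr_ge0.
    lra.
  apply: le_trans (_ : u * (1 + u / 2) * expR (- u) * w <= _); last first.
    by rewrite ler_wpM2r// expR_linear_bound.
  have := ler_wpM2l (mulr_ge0 u0 q0) h; lra.
have h : (u + w) * z <= u * w.
  have : 0 <= (u - 2) * (w - z) by rewrite mulr_ge0 ?subr_ge0// ltW.
  lra.
apply: le_trans (_ : u ^+ 2 * expR (- u) * w <= _); last first.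
  by rewrite ler_wpM2r// expR_sq_bound// ltW.
have := ler_wpM2l (mulr_ge0 u0 q0) h; lra.
Qed.
End Scalars.

(** * The divided differences of exp(-1/x) *)

Section Kernel.
Variable R : realType.
Implicit Types d s T mu nu : R.

(** The function exp(-1/x) extended by its limit at 0. The value 0 is essential: the Nyström matrix
    may be singular, and the reduced propagator vanishes on its kernel. *)
Definition expNV mu : R := if mu == 0 then 0 else expR (- mu^-1).

(* In what follows mu = 0 stands for 1/mu = +oo. With 0^-1 = 0 the functions phi,
   gker and rker take their limit value 0 there; chi has to be set to 1. *)
Definition phi mu : R := mu^-1 * expR (- mu^-1).

Definition chi mu : R :=
  if mu == 0 then 1 else 1 - expR (- mu^-1) - phi mu / 2.

Definition gker s mu : R :=
  mu^-1 * (expR (- ((1 - s) * mu^-1)) - expR (- mu^-1)).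

(** The integral of [expR (x * d)] over x from 0 to [T], in closed form. *)
Definition int_exp d T : R := if d == 0 then T else (expR (T * d) - 1) / d.

(* The integral of gker s mu * gker (1 - s) nu for s from 0 to T. *)
Definition rker T mu nu : R :=
  mu^-1 * nu^-1 * expR (- mu^-1) *
  (int_exp (mu^-1 - nu^-1) T - expR (- nu^-1) * int_exp mu^-1 T
   - int_exp (- nu^-1) T + expR (- nu^-1) * T).

Definition hker mu nu : R := phi mu * chi nu + chi mu * phi nu + rker 1 mu nu.

Lemma is_derive_int_exp d T : is_derive T 1 (int_exp d) (expR (T * d)).
Proof.
rewrite /int_exp; have [->|d0] := eqVneq d 0.
  by rewrite mulr0 expR0; exact: is_derive_id.
by apply: is_derive_eq; rewrite /GRing.scale /=; field.
Qed.

Lemma is_derive_rker T mu nu :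
  is_derive T 1 (fun T => rker T mu nu) (gker T mu * gker (1 - T) nu).
Proof.
rewrite /rker /gker; set a := mu^-1; set b := nu^-1.
have h1 := is_derive_int_exp (a - b) T.
have h2 := is_derive_int_exp a T.
have h3 := is_derive_int_exp (- b) T.
apply: is_derive_eq; rewrite /GRing.scale /=.
have -> : - ((1 - T) * a) = T * a - a by ring.
have -> : - ((1 - (1 - T)) * b) = - (T * b) by ring.
have -> : T * (a - b) = T * a - T * b by ring.
rewrite mulrN !expRD; ring.
Qed.

Lemma rker0 mu nu : rker 0 mu nu = 0.
Proof.
have i0 d : int_exp d 0 = 0.
  by rewrite /int_exp; case: eqP => // _; rewrite mul0r expR0 subrr mul0r.
by rewrite /rker !i0; ring.
Qed.

(** For distinct nonzero arguments the first summand of [rker 1] is already the divided difference.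
    The other three cancel against the [phi], [chi] terms, which is what the correction
    [- phi mu / 2] in [chi] achieves. If one argument is 0, only [phi] of the other survives,
    because [chi 0 = 1]. *)
Lemma hkerE mu nu : (mu - nu) * hker mu nu = expNV mu - expNV nu.
Proof.
have [->|mn] := eqVneq mu nu; first by rewrite !subrr mul0r.
rewrite /hker /expNV /chi /rker /phi.
have [m0|m0] := eqVneq mu 0; have [n0|n0] := eqVneq nu 0.
- by move: mn; rewrite m0 n0 eqxx.
- by rewrite m0 invr0; field.
- by rewrite n0 invr0; field.
rewrite /int_exp !mul1r subr_eq0 oppr_eq0 !invr_eq0 (negbTE m0) (negbTE n0).
rewrite (inj_eq invr_inj) (negbTE mn) !expRD !expRN.
have := expR_eq0 mu^-1; have := expR_eq0 nu^-1.
set x := expR mu^-1; set y := expR nu^-1 => /negbT y0 /negbT x0.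
field; rewrite y0 x0 n0 m0 mulN1r subr_eq0 eq_sym mn //.
Qed.

Lemma phi_chi_bound mu : 0 <= mu ->
  9 / 4 * phi mu ^+ 2 + 4 / 9 * chi mu ^+ 2 <= 46 / 100.
Proof.
move=> m0; rewrite /chi /phi; case: eqP => [->|_].
  by rewrite invr0; lra.
by apply: weighted_sq_bound; rewrite invr_ge0.
Qed.

Lemma gker_ge0 s mu : 0 < s -> 0 <= mu -> 0 <= gker s mu.
Proof.
move=> s0; rewrite -invr_ge0 /gker => a0.
rewrite mulr_ge0// subr_ge0 ler_expR lerN2 ler_piMl//; lra.
Qed.

Lemma gker_le s mu : 0 < s < 1 -> 0 <= mu ->
  (1 - s) * gker s mu <= 59 / 100 * s.
Proof.
move=> /andP[s0 s1] m0; rewrite /gker.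
have : 0 <= mu^-1 by rewrite invr_ge0.
rewrite le_eqVlt => /predU1P[<-|a0]; first by rewrite mul0r mulr0; lra.
set a := mu^-1 in a0 *.
have u0 : 0 <= (1 - s) * a by rewrite mulr_ge0; lra.
have w0 : 0 <= s * a by rewrite mulr_ge0; lra.
(* Multiplied by [a], the claim is [expR_diff_bound] at [u = (1 - s) * a] and [w = s * a], for which
   [u + w = a]. *)
rewrite -(ler_pM2r a0) -[leRHS]mulrA.
apply: le_trans (expR_diff_bound u0 w0).
have -> : - a = - ((1 - s) * a) + - (s * a) by ring.
rewrite (expRD (- ((1 - s) * a))).
lra.
Qed.
End Kernel.

(** * Schur multipliers *)

(** For [c >= 0] this encodes that the spectral norm of [W] is at most [c]: rescaling [x] and [y] by
    reciprocal factors turns the right-hand side into [2 * c * |x| * |y|]. No square root occurs,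
    and such bounds can be added and integrated. *)
Definition bilin_le (R : realType) m n (W : 'M[R]_(m, n)) (c : R) : Prop :=
  forall (x : 'I_m -> R) (y : 'I_n -> R),
    2 * (\sum_i \sum_j x i * W i j * y j)
      <= c * (\sum_i x i ^+ 2 + \sum_j y j ^+ 2).

Definition schur (R : realType) m n (h : 'I_m -> 'I_n -> R)
    (W : 'M[R]_(m, n)) : 'M[R]_(m, n) := \matrix_(i, j) (h i j * W i j).

Lemma is_derive_sum_ord (R : realType) n (f : 'I_n -> R -> R) (df : 'I_n -> R)
    (x : R) :
  (forall i, is_derive x 1 (f i) (df i)) ->
  is_derive x 1 (fun y => \sum_i f i y) (\sum_i df i).
Proof.
move=> h; rewrite (_ : (fun y => \sum_i f i y) = \sum_i f i).
  exact: is_derive_sum.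
by apply/funext => y; rewrite fct_sumE.
Qed.

Section Schur.
Context (R : realType) (m n : nat).
Variables (mu : 'I_m -> R) (nu : 'I_n -> R).
Hypotheses (mu0 : forall i, 0 <= mu i) (nu0 : forall j, 0 <= nu j).

(** A multiplier of product form [p (mu i) * q (nu j)] is absorbed into the test vectors [x] and
    [y], where reciprocal weights may be inserted freely. The kernel [hker] is a sum of two such
    products and an integral of further ones. *)
Lemma schur_hker (W : 'M[R]_(m, n)) (M : R) :
  0 <= M -> bilin_le W M ->
  bilin_le (schur (fun i j => hker (mu i) (nu j)) W)
    ((46 / 100 + (59 / 100) ^+ 2) * M).
Proof.
move=> M0 WM x y.
set X := \sum_i x i ^+ 2; set Y := \sum_j y j ^+ 2.
pose c : R := 46 / 100; pose k : R := 59 / 100.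
pose B (f : 'I_m -> R) (g : 'I_n -> R) := \sum_i \sum_j f i * W i j * g j.
have BZ a b f g : B (fun i => a * f i) (fun j => b * g j) = a * b * B f g.
  rewrite /B mulr_sumr; apply: eq_bigr => i _; rewrite mulr_sumr.
  by apply: eq_bigr => j _; ring.
have hr : 2 * (\sum_i \sum_j x i * (rker 1 (mu i) (nu j) * W i j) * y j)
    <= k ^+ 2 * M * (X + Y).
  (* Integration over s is replaced by monotonicity: [r] is an antiderivative of the form [b] with
     [r 0 = 0], so a pointwise bound on [b] makes [F] nondecreasing. *)
  pose r T := \sum_i \sum_j x i * (rker T (mu i) (nu j) * W i j) * y j.
  pose b T := B (fun i => gker T (mu i) * x i)
    (fun j => gker (1 - T) (nu j) * y j).
  have dr (T : R) : is_derive T 1 r (b T).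
    apply: is_derive_sum_ord => i; apply: is_derive_sum_ord => j.
    have h := is_derive_rker T (mu i) (nu j).
    by apply: is_derive_eq; rewrite /GRing.scale /=; ring.
  pose F T : R := k ^+ 2 * M * (X + Y) * T - 2 * r T.
  suff : F 0 <= F 1.
    rewrite /F /r; under eq_bigr do under eq_bigr do rewrite rker0 mul0r mulr0 mul0r.
    rewrite big1 => [|i _]; last by rewrite big1.
    by rewrite !mulr0 subr0 mulr1 subr_ge0.
  apply: (@ge0_derive_le _ F (fun T => k ^+ 2 * M * (X + Y) - 2 * b T)) => // T.
    have h := dr T.
    by apply: is_derive_eq; rewrite /GRing.scale /=; ring.
  move=> /andP[T0 T1]; rewrite subr_ge0.
  have T1' : 0 < 1 - T by rewrite subr_gt0.
  (* This weight balances the two factors: by [gker_le], used at [T] and at [1 - T], both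
     [z * gker T] and [z^-1 * gker (1 - T)] are at most [k]. *)
  pose z := (1 - T) / T.
  have z0 : 0 < z by rewrite divr_gt0.
  have gsq s (rho : R) : 0 < s < 1 -> 0 <= rho ->
      ((1 - s) / s * gker s rho) ^+ 2 <= k ^+ 2.
    move=> /andP[s0 s1] rho0; rewrite lerXn2r// ?nnegrE.
    - by rewrite mulr_ge0 ?gker_ge0// divr_ge0 ?subr_ge0 ?(ltW s0) ?(ltW s1).
    - by rewrite /k; lra.
    - by rewrite mulrAC ler_pdivrMr// gker_le// s0.
  have := WM (fun i => z * (gker T (mu i) * x i))
             (fun j => z^-1 * (gker (1 - T) (nu j) * y j)).
  rewrite -/(B _ _) BZ mulfV ?gt_eqF// mul1r -/(b T) => /le_trans; apply.
  rewrite (mulrC _ M) -mulrA ler_wpM2l// mulrDr lerD//.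
    rewrite /X mulr_sumr ler_sum// => i _; rewrite mulrA exprMn.
    by rewrite ler_wpM2r ?sqr_ge0// gsq// T0 T1.
  rewrite /Y mulr_sumr ler_sum// => j _; rewrite mulrA exprMn.
  rewrite ler_wpM2r ?sqr_ge0// /z invf_div.
  by have := gsq (1 - T) (nu j); rewrite subKr; apply => //; rewrite T1' gtrBl T0.
(* The reciprocal weights 3/2 and 2/3 produce the sums of squares that [phi_chi_bound] controls,
   once for [x] and once for [y]. *)
have h1 := WM (fun i => 3 / 2 * (phi (mu i) * x i))
              (fun j => 2 / 3 * (chi (nu j) * y j)).
have h2 := WM (fun i => 2 / 3 * (chi (mu i) * x i))
              (fun j => 3 / 2 * (phi (nu j) * y j)).
move: h1 h2; rewrite -!/(B _ _) !BZ => h1 h2.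
have -> : \sum_i \sum_j x i * schur (fun i j => hker (mu i) (nu j)) W i j * y j
  = B (fun i => phi (mu i) * x i) (fun j => chi (nu j) * y j)
  + B (fun i => chi (mu i) * x i) (fun j => phi (nu j) * y j)
  + \sum_i \sum_j x i * (rker 1 (mu i) (nu j) * W i j) * y j.
  rewrite /B -!big_split; apply: eq_bigr => i _; rewrite -!big_split.
  by apply: eq_bigr => j _ /=; rewrite mxE /hker; ring.
have sq p q (g z : 'I_p -> R) :
    \sum_i (q * (g i * z i)) ^+ 2 = q ^+ 2 * \sum_i g i ^+ 2 * z i ^+ 2.
  by rewrite mulr_sumr; apply: eq_bigr => i _; rewrite !exprMn.
have bnd p (rho z : 'I_p -> R) : (forall i, 0 <= rho i) ->
    9 / 4 * (\sum_i phi (rho i) ^+ 2 * z i ^+ 2)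
    + 4 / 9 * (\sum_i chi (rho i) ^+ 2 * z i ^+ 2) <= c * \sum_i z i ^+ 2.
  move=> rho0; rewrite !mulr_sumr -big_split ler_sum// => i _ /=.
  have := ler_wpM2r (sqr_ge0 (z i)) (phi_chi_bound (rho0 i)).
  by rewrite mulrDl -!(mulrA _ (_ ^+ 2) (_ ^+ 2)).
have b1 := ler_wpM2l M0 (bnd _ mu x mu0).
have b2 := ler_wpM2l M0 (bnd _ nu y nu0).
rewrite !sq// in h1 h2; rewrite -/X -/Y -/c -/k in b1 b2 *.
move: h1 h2 b1 b2 hr.
lra.
Qed.
End Schur.

(** * Spectral theorem for real symmetric matrices *)

Section RealSpectral.
Variable R : realType.

Lemma trmx11 (A : 'M[R]_1) : A^T = A.
Proof. by rewrite [A]mx11_scalar tr_scalar_mx. Qed.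

Lemma dotmx_ge0 n (z : 'cV[R]_n) : 0 <= (z^T *m z) 0 0.
Proof. by rewrite mxE sumr_ge0// => k _; rewrite mxE -expr2 sqr_ge0. Qed.

Lemma dotmx_eq0 n (z : 'cV[R]_n) : ((z^T *m z) 0 0 == 0) = (z == 0).
Proof.
apply/eqP/eqP => [|->]; last by rewrite mulmx0 mxE.
rewrite mxE => /eqP; rewrite psumr_eq0 => [/allP h|k _]; last first.
  by rewrite mxE -expr2 sqr_ge0.
apply/colP => i; have := h i (mem_index_enum _).
by rewrite !mxE mulf_eq0 orbb => /eqP.
Qed.

Lemma dotmx_gt0 n (z : 'cV[R]_n) : z != 0 -> 0 < (z^T *m z) 0 0.
Proof. by move=> z0; rewrite lt_neqAle eq_sym dotmx_eq0 z0 dotmx_ge0. Qed.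

(* A complex eigenvector [x + i y] with eigenvalue [a + i b] satisfies
   [b * (|x|^2 + |y|^2) = 0] because [x^T A y = y^T A x]. *)
Lemma sym_eigen n (A : 'M[R]_n.+1) : A^T = A ->
  exists (a : R) (v : 'cV[R]_n.+1), v != 0 /\ A *m v = a *: v.
Proof.
move=> sA.
pose f : {rmorphism R -> complex R} := real_complex R.
have [c] : exists c, eigenvalue (map_mx f A) c.
  have /closed_rootP [c rc] : size (char_poly (map_mx f A)) != 1%N.
    by rewrite size_char_poly.
  by exists c; rewrite eigenvalue_root_char.
move=> /eigenvalueP[w /rowP wA w0].
pose x : 'cV[R]_n.+1 := \col_i complex.Re (w 0 i).
pose y : 'cV[R]_n.+1 := \col_i complex.Im (w 0 i).
have re (g : complex R -> R) i : g 0 = 0 -> {morph g : a b / a + b} ->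
    (forall a b, g (a * f b) = b * g a) ->
    g (c * w 0 i) = (A *m \col_i g (w 0 i)) i 0.
  move=> g0 gD gM; have := wA i; rewrite !mxE => <-.
  rewrite (big_morph g gD g0); apply: eq_bigr => k _.
  by rewrite !mxE gM -[in LHS]sA mxE.
pose a := complex.Re c; pose b := complex.Im c.
have cw i : c * w 0 i
    = ((a * x i 0 - b * y i 0) +i* (a * y i 0 + b * x i 0))%C.
  by rewrite !mxE /a /b; case: (c) => ? ?; case: (w 0 i).
have Ax : A *m x = a *: x - b *: y.
  apply/colP => i; rewrite -(re (@complex.Re R)) ?cw ?mxE//.
  - by case=> ? ? [].
  - by case=> p q r /=; rewrite mulr0 subr0 mulrC.
have Ay : A *m y = a *: y + b *: x.
  apply/colP => i; rewrite -(re (@complex.Im R)) ?cw ?mxE//.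
  - by case=> ? ? [].
  - by case=> p q r /=; rewrite mulr0 add0r mulrC.
have xy0 : (x != 0) || (y != 0).
  rewrite -negb_and; apply: contraNN w0 => /andP[/eqP/colP x0 /eqP/colP y0].
  apply/eqP/rowP => i; have := x0 i; have := y0 i; rewrite !mxE.
  by case: (w 0 i) => ? ? /= -> ->.
have : x^T *m (A *m y) = y^T *m (A *m x).
  by rewrite -[LHS]trmx11 !trmx_mul trmxK sA mulmxA.
rewrite Ax Ay !mulmxDr mulmxN -!scalemxAr -[x^T *m y]trmx11 trmx_mul trmxK.
move=> /addrI/matrixP/(_ 0 0) /eqP; rewrite mxE [eqbRHS]mxE [in eqbRHS]mxE.
rewrite -subr_eq0 opprK -mulrDr mulf_eq0 => /orP[/eqP b0|]; last first.
  rewrite paddr_eq0 ?dotmx_ge0// !dotmx_eq0 => /andP[x0 y0].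
  by move: xy0; rewrite x0 y0.
have [x0|y0] := orP xy0.
  by exists a, x; rewrite Ax b0 scale0r subr0.
by exists a, y; rewrite Ay b0 scale0r addr0.
Qed.

(** For [u] different from the first basis vector [e], [H] is the reflection along [w = u - e]. It
    exchanges [e] and [u] because they have equal length, which gives [w^T *m e = - |w|^2 / 2]. It
    serves to move an eigenvector to the first coordinate. *)
Lemma householder n (u : 'cV[R]_n.+1) : u^T *m u = 1%:M ->
  exists H : 'M[R]_n.+1, [/\ H^T = H, H *m H = 1%:M & H *m delta_mx 0 0 = u].
Proof.
move=> uu; set e : 'cV[R]_n.+1 := delta_mx 0 0.
have ee : e^T *m e = 1%:M.
  by rewrite trmx_delta mul_delta_mx; apply/matrixP => i j; rewrite !ord1 !mxE.
have [ue|ue] := eqVneq u e.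
  by exists 1%:M; rewrite trmx1 !mul1mx.
set w := u - e; set c := (w^T *m w) 0 0.
have ww : w^T *m w = c%:M by rewrite [LHS]mx11_scalar.
have c0 : c != 0 by rewrite dotmx_eq0 subr_eq0.
pose H : 'M[R]_n.+1 := 1%:M - (2 / c) *: (w *m w^T).
have HT : H^T = H by rewrite /H linearB /= trmx1 linearZ /= trmx_mul trmxK.
have wwww : w *m w^T *m (w *m w^T) = c *: (w *m w^T).
  by rewrite mulmxA -(mulmxA w) ww mul_mx_scalar -scalemxAl.
have ewe : w^T *m e = (- (c / 2))%:M.
  have eu : e^T *m u = u^T *m e by rewrite -[LHS]trmx11 trmx_mul trmxK.
  have wT : w^T = u^T - e^T by rewrite /w linearB.
  have := ww; rewrite wT [in LHS]/w mulmxBl !mulmxBr uu ee eu.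
  rewrite mulmxBl ee [u^T *m e]mx11_scalar.
  move=> /matrixP/(_ 0 0); rewrite !mxE !mulr1n => h.
  by apply/matrixP => i j; rewrite !ord1 !mxE !mulr1n -h; field.
exists H; split => //.
  rewrite /H mulmxBl mul1mx mulmxBr mulmx1 -scalemxAl -scalemxAr wwww !scalerA.
  have -> : 2 / c * (2 / c) * c = 2 / c + 2 / c by field.
  by rewrite scalerDl opprB addrK subrK.
rewrite /H mulmxBl mul1mx -scalemxAl -mulmxA ewe mul_mx_scalar scalerA.
have -> : 2 / c * - (c / 2) = -1 by field.
by rewrite scaleN1r opprK /w addrC subrK.
Qed.

(** Deflation: after a reflection taking [e_0] to a unit eigenvector, the first column is [a * e_0].
    By symmetry the matrix then splits into the scalar [a] and a smaller symmetric block, to which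
    the induction applies. *)
Theorem sym_spectral n (A : 'M[R]_n) : A^T = A ->
  exists (Q : 'M[R]_n) (d : 'rV[R]_n),
    Q *m Q^T = 1%:M /\ A = Q *m diag_mx d *m Q^T.
Proof.
elim: n A => [|n IH] A sA.
  by exists 1%:M, 0; split; apply/matrixP => -[].
have [a [v [v0 Av]]] := sym_eigen sA.
pose s := (v^T *m v) 0 0.
have s0 : 0 < s by exact: dotmx_gt0.
pose u := (Num.sqrt s)^-1 *: v.
have uu : u^T *m u = 1%:M.
  have -> : u^T = (Num.sqrt s)^-1 *: v^T by rewrite linearZ.
  rewrite /u -scalemxAl -scalemxAr scalerA [v^T *m v]mx11_scalar -/s.
  by rewrite -invfM -expr2 sqr_sqrtr ?(ltW s0)// scale_scalar_mx mulVf ?gt_eqF.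
have Au : A *m u = a *: u by rewrite /u -scalemxAr Av !scalerA mulrC.
have [H [HT HH He]] := householder uu.
pose B : 'M[R]_(1 + n) := H *m A *m H.
have BT : B^T = B by rewrite /B !trmx_mul HT sA mulmxA.
have AE : A = H *m B *m H by rewrite /B !mulmxA HH mul1mx -mulmxA HH mulmx1.
have Be : B *m delta_mx 0 0 = a *: (delta_mx 0 0 : 'cV_n.+1).
  by rewrite /B -!mulmxA He Au -scalemxAr -He mulmxA HH mul1mx.
have Bc (i : 'I_(1 + n)) : B i 0 = a *+ (i == 0).
  by have /colP/(_ i) := Be; rewrite -colE !mxE eqxx andbT mulr_natr.
clearbody B.
have l0 : lshift n (0 : 'I_1) = (0 : 'I_n.+1) by exact: val_inj.
have ul : ulsubmx B = a%:M.
  by apply/matrixP => i j; rewrite !ord1 !mxE l0 Bc.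
have dl : dlsubmx B = 0.
  by apply/matrixP => i j; rewrite !ord1 !mxE l0 Bc.
have ur : ursubmx B = 0.
  by apply: trmx_inj; rewrite trmx_ursub BT dl trmx0.
have [|Q' [d' [QQ' eB]]] := IH (drsubmx B); first by rewrite trmx_drsub BT.
have EB : B = block_mx a%:M 0 0 (drsubmx B) by rewrite -ul -dl -ur submxK.
pose U : 'M[R]_(1 + n) := block_mx 1%:M 0 0 Q'.
pose D : 'rV[R]_(1 + n) := row_mx a%:M d'.
have UT : U^T = block_mx 1%:M 0 0 Q'^T by rewrite tr_block_mx !trmx0 trmx1.
have UU : U *m U^T = 1%:M.
  rewrite UT mulmx_block !mul0mx !mulmx0 mul1mx QQ' !addr0 !add0r.
  by rewrite -scalar_mx_block.
have UBU : B = U *m diag_mx D *m U^T.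
  rewrite UT diag_mx_row !mulmx_block !mul0mx !mulmx0 !mul1mx !mulmx1.
  rewrite {1}EB; congr block_mx; last by rewrite !add0r eB.
  - by apply/matrixP => i j; rewrite !ord1 !mxE !addr0.
  - by rewrite addr0 mul0mx addr0.
  - by rewrite !addr0.
exists (H *m U), D; rewrite trmx_mul HT; split.
  by rewrite mulmxA -(mulmxA H) UU mulmx1.
by rewrite AE UBU !mulmxA.
Qed.
End RealSpectral.

(** * Matrix exponential *)

Section MatrixExponential.
Variable R : realType.
Local Open Scope classical_set_scope.

Lemma cvg_mx m n (F : nat -> 'M[R]_(m, n)) (L : 'M[R]_(m, n)) :
  (forall i j, (fun k => F k i j) @ \oo --> L i j) -> F @ \oo --> L.
Proof.
move=> h; apply/cvgrPdist_lt => e e0.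
have : \forall k \near \oo, forall ij : 'I_m * 'I_n,
    `|L ij.1 ij.2 - F k ij.1 ij.2| < e.
  by apply: filter_forall => -[i j] /=; move/cvgrPdist_lt : (h i j); apply.
apply: filterS => k hk; rewrite /Num.norm /= mx_normrE.
by apply: bigmax_lt => // ij _; rewrite !mxE.
Qed.

Lemma cvg_sum_ord n (f : 'I_n -> nat -> R) (l : 'I_n -> R) :
  (forall i, f i @ \oo --> l i) ->
  (fun k => \sum_i f i k) @ \oo --> \sum_i l i.
Proof.
move=> h; rewrite (_ : (fun k => _) = \sum_i f i).
  by elim/big_ind2 : _ => [|? ? ? ? ? ?|i _]; [exact: cvg_cst|exact: cvgD|exact: h].
by apply/funext => k; rewrite fct_sumE.
Qed.

Lemma expr_diag_orth n (Q : 'M[R]_n) (d : 'rV[R]_n) k :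
  Q *m Q^T = 1%:M ->
  (Q *m diag_mx d *m Q^T) ^+ k
    = Q *m diag_mx (map_mx (fun x => x ^+ k) d) *m Q^T.
Proof.
move=> QQ; elim: k => [|k IH].
  rewrite expr0 (_ : map_mx _ d = const_mx 1).
    by rewrite diag_const_mx mulmx1 QQ.
  by apply/rowP => i; rewrite !mxE.
rewrite exprS IH -mulmxE !mulmxA -(mulmxA _ Q^T) (mulmx1C QQ) mulmx1.
congr (_ *m _); rewrite -!mulmxA mulmx_diag; congr (_ *m diag_mx _).
by apply/rowP => i; rewrite !mxE exprS.
Qed.

(** Each entry of a partial sum is a fixed finite combination of partial sums of scalar exponential
    series, so the limit can be taken entrywise. *)
Lemma expmx_diag_orth n (Q : 'M[R]_n) (d : 'rV[R]_n) :
  Q *m Q^T = 1%:M ->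
  expmx (Q *m diag_mx d *m Q^T) = Q *m diag_mx (map_mx expR d) *m Q^T.
Proof.
move=> QQ; rewrite /expmx; apply: cvg_lim => //; apply: cvg_mx => i j.
have entry (c : 'rV[R]_n) :
    (Q *m diag_mx c *m Q^T) i j = \sum_l Q i l * Q j l * c 0 l.
  rewrite mxE; apply: eq_bigr => l _; rewrite mul_mx_diag !mxE; ring.
rewrite entry.
rewrite (_ : (fun k => _) =
  (fun k => \sum_l Q i l * Q j l * series (exp_coeff (d 0 l)) k)).
  apply: cvg_sum_ord => l; rewrite mxE; apply: cvgM; first exact: cvg_cst.
  exact: is_cvg_series_exp_coeff.
apply/funext => N; rewrite seriesEord /= summxE.
have -> :
    \sum_(k < N) ((k`!%:R)^-1 *: (Q *m diag_mx d *m Q^T) ^+ k : 'M[R]_n) i j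
    = \sum_(k < N) \sum_l (k`!%:R)^-1 * (Q i l * Q j l * d 0 l ^+ k).
  apply: eq_bigr => k _; rewrite mxE expr_diag_orth// entry mulr_sumr.
  by apply: eq_bigr => l _; rewrite mxE.
rewrite exchange_big; apply: eq_bigr => l _ /=.
rewrite seriesEord /= mulr_sumr; apply: eq_bigr => k _.
by rewrite /exp_coeff /=; ring.
Qed.
End MatrixExponential.

(** * Singular values and norms *)

Section SingularValues.
Variable R : realType.

Lemma char_poly_diag_orth n (Q : 'M[R]_n) (d : 'rV[R]_n) :
  Q *m Q^T = 1%:M ->
  char_poly (Q *m diag_mx d *m Q^T) = \prod_i ('X - (d 0 i)%:P).
Proof.
move=> QQ; pose f := map_mx (@polyC R).
have ff : f _ _ Q *m (f _ _ Q)^T = 1%:M by rewrite map_trmx -map_mxM QQ map_mx1.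
have -> : char_poly (Q *m diag_mx d *m Q^T) = char_poly (diag_mx d).
  rewrite /char_poly; set D := diag_mx d.
  have -> : char_poly_mx (Q *m D *m Q^T)
      = f _ _ Q *m char_poly_mx D *m (f _ _ Q)^T.
    rewrite /char_poly_mx mulmxBr mulmxBl !map_mxM map_trmx.
    by rewrite mul_mx_scalar -scalemxAl -map_trmx ff scalemx1.
  by rewrite !det_mulmx mulrAC -det_mulmx ff det1 mul1r.
rewrite char_poly_trig ?diag_mx_is_trig//.
by apply: eq_bigr => i _; rewrite mxE eqxx mulr1n.
Qed.

Lemma mup_prod_XsubC (x : R) (s : seq R) :
  mup x (\prod_(y <- s) ('X - y%:P)) = count_mem x s.
Proof.
elim: s => [|y s IH]; first by rewrite big_nil mupNroot// root1.
rewrite big_cons mupM ?polyXsubC_eq0 ?IH//=; last first.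
  exact/monic_neq0/monic_prod_XsubC.
congr (_ + _)%N; have := mup_XsubCX 1 x y; rewrite expr1 => ->.
by rewrite eq_sym; case: eqP.
Qed.

Lemma count_flatten_nseq (T : eqType) (m : T -> nat) (s : seq T) x : uniq s ->
  count_mem x (flatten [seq nseq (m y) y | y <- s])
    = if x \in s then m x else 0%N.
Proof.
elim: s => //= y s IH /andP[ys us]; rewrite count_cat IH// count_nseq inE /=.
rewrite [x == y]eq_sym; have [<-|yx] := eqVneq y x; last by rewrite mul0n.
by rewrite (negbTE ys) mul1n addn0.
Qed.

(** The characteristic polynomial is the product of the ['X - (d 0 i)%:P], so root multiplicities
    count occurrences in [d]. Hence any orthogonal diagonalisation of the Gram matrix may be used to
    compute both norms. *)
Lemma perm_singular_values m n (A : 'M[R]_(m, n)) (Q : 'M[R]_n) (d : 'rV[R]_n) :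
  Q *m Q^T = 1%:M -> A^T *m A = Q *m diag_mx d *m Q^T ->
  perm_eq (singular_values A) [seq Num.sqrt (d 0 i) | i <- enum 'I_n].
Proof.
move=> QQ e; rewrite /singular_values e char_poly_diag_orth//.
set s := [seq d 0 i | i <- enum 'I_n].
have -> : \prod_i ('X - (d 0 i)%:P) = \prod_(y <- s) ('X - y%:P).
  by rewrite big_map big_enum.
set p := \prod_(y <- s) _.
have -> : [seq Num.sqrt (d 0 i) | i <- enum 'I_n] = map Num.sqrt s.
  by rewrite /s -[RHS]map_comp.
suff <- : map Num.sqrt (flatten [seq nseq (mup x p) x | x <- polyrcf.rootsR p])
    = flatten [seq nseq (mup x p) (Num.sqrt x) | x <- polyrcf.rootsR p].
  apply: perm_map; rewrite /perm_eq; apply/allP => x _ /=; apply/eqP.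
  rewrite count_flatten_nseq ?polyrcf.uniq_roots// -mup_prod_XsubC -/p.
  case: ifPn => // xp; rewrite mupNroot//; apply: contra xp => rx.
  rewrite -(polyrcf.roots_on_rootsR (p := p)) ?rx ?andbT//.
  exact/monic_neq0/monic_prod_XsubC.
rewrite map_flatten; congr flatten; rewrite -[LHS]map_comp.
by apply: eq_map => x /=; rewrite map_nseq.
Qed.

Lemma gram_diag m n (A : 'M[R]_(m, n)) (Q : 'M[R]_n) (d : 'rV[R]_n) :
  Q *m Q^T = 1%:M -> A^T *m A = Q *m diag_mx d *m Q^T ->
  (A *m Q)^T *m (A *m Q) = diag_mx d.
Proof.
move=> QQ e; rewrite trmx_mul mulmxA -(mulmxA Q^T) e !mulmxA (mulmx1C QQ) mul1mx.
by rewrite -mulmxA (mulmx1C QQ) mulmx1.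
Qed.

Lemma svd_data m n (A : 'M[R]_(m, n)) :
  exists (Q : 'M[R]_n) (s : 'I_n -> R),
  [/\ Q *m Q^T = 1%:M, forall i, 0 <= s i,
      A^T *m A = Q *m diag_mx (\row_i s i ^+ 2) *m Q^T
    & perm_eq (singular_values A) [seq s i | i <- enum 'I_n]].
Proof.
have sA : (A^T *m A)^T = A^T *m A by rewrite trmx_mul trmxK.
have [Q [d [QQ e]]] := sym_spectral sA.
exists Q, (fun i => Num.sqrt (d 0 i)); split => //.
  rewrite e; congr (_ *m diag_mx _ *m _); apply/rowP => i; rewrite mxE sqr_sqrtr//.
  have /matrixP/(_ i i) := gram_diag QQ e; rewrite [RHS]mxE eqxx mulr1n => <-; rewrite mxE.
  by apply: sumr_ge0 => k _; rewrite mxE -expr2 sqr_ge0.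
exact: (perm_singular_values QQ e).
Qed.
End SingularValues.

(** * Bilinear bounds for the norms and trace duality *)

Section Norms.
Variable R : realType.

Lemma bilin_leP m n (W : 'M[R]_(m, n)) c :
  bilin_le W c <-> forall (x : 'cV[R]_m) (y : 'cV[R]_n),
    2 * (x^T *m W *m y) 0 0 <= c * ((x^T *m x) 0 0 + (y^T *m y) 0 0).
Proof.
have sq p (z : 'cV[R]_p) : (z^T *m z) 0 0 = \sum_i z i 0 ^+ 2.
  by rewrite mxE; apply: eq_bigr => i _; rewrite mxE expr2.
have bil (x : 'cV[R]_m) (y : 'cV[R]_n) :
    (x^T *m W *m y) 0 0 = \sum_i \sum_j x i 0 * W i j * y j 0.
  rewrite mxE exchange_big; apply: eq_bigr => j _ /=.
  by rewrite mxE mulr_suml; apply: eq_bigr => i _; rewrite mxE.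
split => [h x y|h x y]; first by rewrite bil !sq; exact: h.
have := h (\col_i x i) (\col_j y j); rewrite bil !sq.
under eq_bigr do under eq_bigr do rewrite !mxE.
under [in X in c * (X + _)]eq_bigr do rewrite mxE.
by under [in X in c * (_ + X)]eq_bigr do rewrite mxE.
Qed.

Lemma orth_dotmx n (U : 'M[R]_n) (x : 'cV[R]_n) : U *m U^T = 1%:M ->
  (U *m x)^T *m (U *m x) = x^T *m x.
Proof.
by move=> /mulmx1C UU; rewrite trmx_mul mulmxA -(mulmxA x^T) UU mulmx1.
Qed.

Lemma bilin_le_orth m n (U : 'M[R]_m) (V : 'M[R]_n) (W : 'M[R]_(m, n)) c :
  U *m U^T = 1%:M -> V *m V^T = 1%:M ->
  bilin_le W c -> bilin_le (U^T *m W *m V) c.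
Proof.
move=> UU VV /bilin_leP h; apply/bilin_leP => x y.
have := h (U *m x) (V *m y); rewrite !orth_dotmx//.
by rewrite trmx_mul !mulmxA.
Qed.

(** The eigenvalue bound gives [|A y|^2 <= c^2 |y|^2]. Expanding [0 <= |c x - A y|^2] and dividing
    by [c] then yields the claim; for [c = 0] the vector [A y] vanishes. *)
Lemma bilin_le_gram m n (A : 'M[R]_(m, n)) (Q : 'M[R]_n) (d : 'rV[R]_n) c :
  Q *m Q^T = 1%:M -> A^T *m A = Q *m diag_mx d *m Q^T ->
  0 <= c -> (forall i, d 0 i <= c ^+ 2) -> bilin_le A c.
Proof.
move=> QQ e c0 dc; apply/bilin_leP => x y.
set z := A *m y.
have zy : (z^T *m z) 0 0 <= c ^+ 2 * (y^T *m y) 0 0.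
  have QQT : Q^T *m Q^T^T = 1%:M by rewrite trmxK (mulmx1C QQ).
  pose w := Q^T *m y.
  have -> : z^T *m z = w^T *m diag_mx d *m w.
    by rewrite /z trmx_mul mulmxA -(mulmxA y^T) e /w trmx_mul trmxK !mulmxA.
  have -> : y^T *m y = w^T *m w by rewrite orth_dotmx.
  clearbody w; rewrite mul_mx_diag !mxE mulr_sumr ler_sum// => i _; rewrite !mxE.
  by rewrite mulrAC mulrC ler_wpM2r// -expr2 sqr_ge0.
rewrite -mulmxA -/z; move: c0; rewrite le_eqVlt => /predU1P[c0|c0].
  move: zy; rewrite -c0 expr0n mul0r => zy.
  have /eqP : (z^T *m z) 0 0 == 0 by rewrite eq_le zy dotmx_ge0.
  by move/eqP; rewrite dotmx_eq0 => /eqP ->; rewrite mulmx0 mxE mulr0 mul0r.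
have := dotmx_ge0 (c *: x - z).
have -> : (c *: x - z)^T = c *: x^T - z^T by rewrite linearB linearZ.
rewrite mulmxBl !mulmxBr -!scalemxAl -!scalemxAr.
have -> : z^T *m x = x^T *m z by rewrite -[LHS]trmx11 trmx_mul trmxK.
move: (x^T *m z) zy => a.
rewrite !mxE.
set xx := \sum_j _; set zz := \sum_j _; set yy := \sum_j _ => zy h.
rewrite -(ler_pM2l c0); lra.
Qed.

(** For [s > 0], [s^-1 *: (A *m q)] is the unit left singular vector paired with [q], and the bound
    on [W] is tested on this pair. *)
Lemma bilin_le_svd m n (A W : 'M[R]_(m, n)) (q : 'cV[R]_n) (s c : R) :
  q^T *m q = 1%:M -> (A *m q)^T *m (A *m q) = (s ^+ 2)%:M ->
  0 <= s -> bilin_le W c -> ((A *m q)^T *m W *m q) 0 0 <= c * s.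
Proof.
move=> qq AA s0 /bilin_leP hW.
move: s0; rewrite le_eqVlt => /predU1P[s0|s0].
  have /eqP : ((A *m q)^T *m (A *m q)) 0 0 == 0 by rewrite AA mxE -s0 expr0n.
  move/eqP; rewrite dotmx_eq0 => /eqP ->.
  by rewrite -s0 trmx0 !mul0mx mxE mulr0.
have := hW (s^-1 *: (A *m q)) q.
have -> : (s^-1 *: (A *m q))^T = s^-1 *: (A *m q)^T by rewrite linearZ.
rewrite -!scalemxAl -scalemxAr scalerA AA qq scale_scalar_mx.
have -> : s^-1 * s^-1 * s ^+ 2 = 1 by field; rewrite gt_eqF.
set B := _ *m W *m q; rewrite [(_ *: B) 0 0]mxE !mxE !mulr1n => h.
rewrite -ler_pdivrMr// mulrC; lra.
Qed.

Lemma svd_col m n (A : 'M[R]_(m, n)) (Q : 'M[R]_n) (d : 'rV[R]_n) k :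
  Q *m Q^T = 1%:M -> A^T *m A = Q *m diag_mx d *m Q^T ->
  (col k Q)^T *m col k Q = 1%:M /\
  (A *m col k Q)^T *m (A *m col k Q) = (d 0 k)%:M.
Proof.
move=> QQ e; have ek : (delta_mx k 0 : 'cV[R]_n)^T *m delta_mx k 0 = 1%:M.
  by rewrite trmx_delta mul_delta_mx; apply/matrixP => i j; rewrite !ord1 !mxE.
rewrite !colE; set u := delta_mx k 0 in ek *.
split; first by rewrite trmx_mul mulmxA -(mulmxA _ Q^T) (mulmx1C QQ) mulmx1.
have -> : A *m (Q *m u) = A *m Q *m u by rewrite mulmxA.
rewrite trmx_mul mulmxA -(mulmxA _ (A *m Q)^T) (gram_diag QQ e).
rewrite /u trmx_delta -rowE -colE.
by apply/matrixP => i j; rewrite !ord1 !mxE eqxx.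
Qed.

Lemma bilin_le_spectral_norm m n (A : 'M[R]_(m, n)) :
  bilin_le A (spectral_norm A).
Proof.
have [Q [s [QQ s0 e ps]]] := svd_data A.
have sle i : s i <= spectral_norm A.
  apply: (Order.TotalTheory.bigmax_sup_seq 0 (s i)) => //.
  by rewrite (perm_mem ps) map_f// mem_enum.
have S0 : 0 <= spectral_norm A by exact: bigmax_ge_id.
apply: (bilin_le_gram QQ e) => // i.
by rewrite mxE lerXn2r// nnegrE.
Qed.

Lemma spectral_norm_le m n (A : 'M[R]_(m, n)) c :
  0 <= c -> bilin_le A c -> spectral_norm A <= c.
Proof.
move=> c0 Ac; have [Q [s [QQ s0 e ps]]] := svd_data A.
rewrite /spectral_norm big_seq; apply: bigmax_le => // x.
rewrite (perm_mem ps) => /mapP[i _ ->].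
have [qq AA] := svd_col i QQ e; rewrite mxE in AA.
have := bilin_le_svd qq AA (s0 i) Ac.
rewrite -mulmxA AA mxE mulr1n expr2.
have [->//|si] := eqVneq (s i) 0.
by rewrite ler_pM2r// lt_neqAle eq_sym si s0.
Qed.

(** The witness is the partial isometry of the polar decomposition, [A *m Q *m D *m Q^T] with [D]
    inverting the singular values. The convention [0^-1 = 0] makes it vanish on the kernel of [A],
    so its Gram matrix has eigenvalues 0 and 1 only. *)
Lemma nuclear_norm_dual m n (A : 'M[R]_(m, n)) :
  exists2 W : 'M[R]_(m, n), bilin_le W 1 & \tr (W^T *m A) = nuclear_norm A.
Proof.
have [Q [s [QQ s0 e ps]]] := svd_data A.
pose D : 'M[R]_n := diag_mx (\row_i (s i)^-1).
have AQ := gram_diag QQ e; set B := A *m Q in AQ.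
have DT : D^T = D by rewrite tr_diag_mx.
have WT : (B *m D *m Q^T)^T = Q *m (D *m B^T) by rewrite !trmx_mul trmxK DT.
exists (B *m D *m Q^T).
  apply: (bilin_le_gram (Q := Q)
    (d := \row_i ((s i)^-1 * (s i ^+ 2 * (s i)^-1)))) => //.
    have -> : diag_mx (\row_i ((s i)^-1 * (s i ^+ 2 * (s i)^-1)))
        = D *m (B^T *m B *m D).
      rewrite AQ !mulmx_diag; congr diag_mx; by apply/rowP => i; rewrite !mxE.
    by rewrite WT !mulmxA.
  move=> i; rewrite mxE expr1n; have [->|si] := eqVneq (s i) 0.
    by rewrite invr0 mul0r.
  by rewrite expr2 mulfK// mulVf.
have -> : nuclear_norm A = \tr (D *m (B^T *m B)).
  rewrite AQ mulmx_diag mxtrace_diag /nuclear_norm (perm_big _ ps) big_map.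
  rewrite big_enum.
  apply: eq_bigr => i _; rewrite !mxE; have [->|si] := eqVneq (s i) 0.
    by rewrite invr0 mul0r.
  by rewrite expr2 mulKf.
by rewrite WT -mulmxA mxtrace_mulC -!mulmxA.
Qed.

Lemma nuclear_norm_ge0 m n (A : 'M[R]_(m, n)) : 0 <= nuclear_norm A.
Proof.
have [Q [s [_ s0 _ ps]]] := svd_data A.
by rewrite /nuclear_norm (perm_big _ ps) big_map; exact: sumr_ge0.
Qed.

(** In a basis of right singular vectors of [A] each diagonal entry of the trace is bounded by [c]
    times one singular value, by [bilin_le_svd]. *)
Lemma mxtrace_le_nuclear_norm m n (A W : 'M[R]_(m, n)) c :
  bilin_le W c -> \tr (W^T *m A) <= c * nuclear_norm A.
Proof.
move=> Wc; have [Q [s [QQ s0 e ps]]] := svd_data A.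
have -> : W^T *m A = W^T *m A *m Q *m Q^T by rewrite -mulmxA QQ mulmx1.
rewrite mxtrace_mulC /mxtrace /nuclear_norm (perm_big _ ps) big_map.
rewrite big_enum mulr_sumr.
apply: ler_sum => i _.
have [qq AA] := svd_col i QQ e; rewrite mxE in AA.
apply: le_trans (bilin_le_svd qq AA (s0 i) Wc).
have -> : (A *m col i Q)^T *m W *m col i Q
    = (col i Q)^T *m (W^T *m A) *m col i Q.
  by rewrite -[LHS]trmx11 !trmx_mul !trmxK !mulmxA.
rewrite !mulmxA tr_col -!row_mul.
rewrite le_eqVlt; apply/predU1P; left; rewrite [LHS]mxE [RHS]mxE [RHS]mxE.
by apply: eq_bigr => j _; rewrite [col _ _ _ _]mxE.
Qed.

(** The spectral bound is direct. For the nuclear norm, Schur multiplication by a real [h] is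
    self-adjoint for the trace pairing, so it can be moved from [E] onto the dual certificate [W],
    where the spectral bound [c] applies. *)
Lemma schur_norm_le n (U V A E : 'M[R]_n) (h : 'I_n -> 'I_n -> R) c :
  U *m U^T = 1%:M -> V *m V^T = 1%:M -> 0 <= c ->
  (forall (W : 'M[R]_n) M, 0 <= M -> bilin_le W M ->
    bilin_le (schur h W) (c * M)) ->
  U^T *m A *m V = schur h (U^T *m E *m V) ->
  spectral_norm A <= c * spectral_norm E /\
  nuclear_norm A <= c * nuclear_norm E.
Proof.
move=> UU VV c0 hc AE.
have UT : U^T *m U^T^T = 1%:M by rewrite trmxK (mulmx1C UU).
have VT : V^T *m V^T^T = 1%:M by rewrite trmxK (mulmx1C VV).
have S0 : 0 <= spectral_norm E by exact: bigmax_ge_id.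
split.
  apply: spectral_norm_le; first by rewrite mulr_ge0.
  have -> : A = U^T^T *m (U^T *m A *m V) *m V^T.
    by rewrite trmxK !mulmxA UU mul1mx -mulmxA VV mulmx1.
  apply: bilin_le_orth => //; rewrite AE; apply: hc => //.
  by apply: bilin_le_orth => //; exact: bilin_le_spectral_norm.
have [W W1 <-] := nuclear_norm_dual A.
pose W' := U^T^T *m schur h (U^T *m W *m V) *m V^T.
have W'c : bilin_le W' c.
  rewrite -[c]mulr1; apply: bilin_le_orth => //; apply: hc => //.
  exact: bilin_le_orth.
apply: le_trans (mxtrace_le_nuclear_norm E W'c).
have trE (X Y : 'M[R]_n) : \tr (X^T *m Y) = \sum_i \sum_j X j i * Y j i.
  by apply: eq_bigr => i _; rewrite mxE; apply: eq_bigr => j _; rewrite mxE.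
have trO (X Y : 'M[R]_n) :
    \tr ((U^T *m X *m V)^T *m (U^T *m Y *m V)) = \tr (X^T *m Y).
  rewrite !trmx_mul trmxK mxtrace_mulC !mulmxA.
  rewrite -(mulmxA _ V) VV mulmx1 mxtrace_mulC !mulmxA UU mul1mx.
  exact: mxtrace_mulC.
have W'E : U^T *m W' *m V = schur h (U^T *m W *m V).
  rewrite /W' trmxK !mulmxA (mulmx1C UU) mul1mx.
  by rewrite -mulmxA (mulmx1C VV) mulmx1.
have sE X a b : schur h X a b = h a b * X a b by rewrite mxE.
rewrite -trO AE -(trO W') W'E !trE le_eqVlt; apply/predU1P; left.
apply: eq_bigr => i _; apply: eq_bigr => j _; rewrite !sE; ring.
Qed.

End Norms.

(** * Perturbation bound and Galerkin projection *)

Section Perturbation.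
Variable R : realType.

Lemma bilin_leZ m n (W : 'M[R]_(m, n)) (a c : R) :
  0 <= a -> bilin_le W c -> bilin_le (a *: W) (a * c).
Proof.
move=> a0 /bilin_leP h; apply/bilin_leP => x y.
rewrite -scalemxAr -scalemxAl; set B := _ *m y.
have -> : (a *: B) 0 0 = a * B 0 0 by rewrite mxE.
rewrite mulrCA -mulrA.
exact: (ler_wpM2l a0 (h x y)).
Qed.

Lemma perturbation_norm_le n (U V : 'M[R]_n) (mu nu : 'rV[R]_n) (t : R) :
  let f (a : 'rV[R]_n) := map_mx (fun x => expNV (x / t)) a in
  let c := (46 / 100 + (59 / 100) ^+ 2) / t in
  let A := U *m diag_mx (f mu) *m U^T - V *m diag_mx (f nu) *m V^T in
  let E := U *m diag_mx mu *m U^T - V *m diag_mx nu *m V^T in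
  U *m U^T = 1%:M -> V *m V^T = 1%:M ->
  (forall i, 0 <= mu 0 i) -> (forall i, 0 <= nu 0 i) -> 0 < t ->
  spectral_norm A <= c * spectral_norm E /\
  nuclear_norm A <= c * nuclear_norm E.
Proof.
move=> f c A E UU VV mu0 nu0 t0.
(* The divided difference of [x -> expNV (x / t)] is that of [expNV] at the rescaled arguments,
   divided by [t]; this is the source of the factor 1/t. *)
pose h i j := hker (mu 0 i / t) (nu 0 j / t) / t.
(* Between the two eigenbases, [A] and [E] are the same matrix [U^T *m V] weighted by differences of
   eigenvalues, so their ratio is the divided difference. *)
have conj (a b : 'rV[R]_n) i j :
    (U^T *m (U *m diag_mx a *m U^T - V *m diag_mx b *m V^T) *m V) i j
    = (a 0 i - b 0 j) * (U^T *m V) i j.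
  have -> : U^T *m (U *m diag_mx a *m U^T - V *m diag_mx b *m V^T) *m V
      = diag_mx a *m (U^T *m V) - (U^T *m V) *m diag_mx b.
    rewrite mulmxBr mulmxBl !mulmxA (mulmx1C UU) mul1mx.
    by rewrite -!(mulmxA _ V^T V) (mulmx1C VV) mulmx1.
  move: (U^T *m V) => X; rewrite mul_diag_mx mul_mx_diag !mxE; ring.
apply: (@schur_norm_le _ _ U V A E h) => //.
- by rewrite divr_ge0 ?(ltW t0)//; lra.
- move=> W M M0 WM.
  have hW := @schur_hker R n n (fun i => mu 0 i / t) (fun j => nu 0 j / t)
    (fun i => divr_ge0 (mu0 i) (ltW t0)) (fun j => divr_ge0 (nu0 j) (ltW t0))
    W M M0 WM.
  have -> : schur h W
      = t^-1 *: schur (fun i j => hker (mu 0 i / t) (nu 0 j / t)) W.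
    by apply/matrixP => i j; rewrite !mxE /h; ring.
  rewrite /c mulrAC [_ * t^-1]mulrC; apply: bilin_leZ => //.
  by rewrite invr_ge0 ltW.
- apply/matrixP => i j; rewrite [RHS]mxE /A /E !conj mulrA; congr (_ * _).
  rewrite !mxE -hkerE /h; field; exact: lt0r_neq0.
Qed.

(** Functional calculus agrees between the thin factorisation by [N] and the full eigenbasis [W].
    The overlap [C = N^T *m W] intertwines the two diagonals, so [C i j] is nonzero only where
    [(m 0 i)^-1 = nu 0 j]; it therefore also intertwines their images under the exponential
    functions. *)
Lemma galerkin_spectral n k (N : 'M[R]_(n, k)) (m : 'rV[R]_k) (W : 'M[R]_n)
    (nu : 'rV[R]_n) t :
  N^T *m N = 1%:M -> (forall i, 0 < m 0 i) -> W *m W^T = 1%:M -> 0 < t ->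
  N *m diag_mx (map_mx (fun x => x^-1) m) *m N^T = W *m diag_mx nu *m W^T ->
  (forall j, 0 <= nu 0 j) /\
  N *m diag_mx (map_mx (fun x => expR (- t * x)) m) *m N^T
    = W *m diag_mx (map_mx (fun x => expNV (x / t)) nu) *m W^T.
Proof.
move=> NN m0 WW t0 eG.
have [C CE] : exists C, C = N^T *m W by exists (N^T *m W).
set D := diag_mx _ in eG.
have WW' := mulmx1C WW.
have GW : N *m D *m C = W *m diag_mx nu.
  by rewrite CE mulmxA eG -mulmxA WW' mulmx1.
have DC : D *m C = C *m diag_mx nu.
  by rewrite -[LHS]mul1mx -NN -!mulmxA (mulmxA N D) GW CE mulmxA.
have DCe i j : (m 0 i)^-1 * C i j = C i j * nu 0 j.
  by have /matrixP/(_ i j) := DC; rewrite mul_diag_mx mul_mx_diag !mxE.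
have nu0 j : 0 <= nu 0 j.
  have /matrixP/(_ j j) : C^T *m (D *m C) = diag_mx nu.
    rewrite mulmxA CE trmx_mul trmxK -CE -!mulmxA (mulmxA N D) GW.
    by rewrite mulmxA WW' mul1mx.
  rewrite [RHS]mxE eqxx mulr1n => <-; rewrite mxE sumr_ge0// => i _.
  rewrite mul_diag_mx !mxE mulrCA.
  by rewrite mulr_ge0 ?invr_ge0 ?(ltW (m0 i))// -expr2 sqr_ge0.
split => //.
set e := diag_mx _; set g := diag_mx _.
have eC : e *m C = C *m g.
  apply/matrixP => i j; rewrite mul_diag_mx mul_mx_diag [LHS]mxE [RHS]mxE.
  have [->|Cij] := eqVneq (C i j) 0; first by rewrite mulr0 mul0r.
  rewrite mulrC; congr (_ * _); rewrite !mxE.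
  have <- : (m 0 i)^-1 = nu 0 j by apply: (mulfI Cij); rewrite -DCe mulrC.
  rewrite /expNV mulf_eq0 !invr_eq0 !gt_eqF//=.
  by rewrite mulNr invfM !invrK [in RHS]mulrC.
(* Columns of [W] with nonzero eigenvalue lie in the range of [N], so [N *m C] reproduces them. The
   remaining columns are killed by [g] since [expNV 0 = 0]. *)
have NCg : N *m C *m g = W *m g.
  apply/matrixP => i j; rewrite !mul_mx_diag [LHS]mxE [RHS]mxE.
  have [n0|n0] := eqVneq (nu 0 j) 0.
    by rewrite [map_mx _ _ _ _]mxE n0 mul0r /expNV eqxx !mulr0.
  congr (_ * _); apply: (mulIf n0).
  have /matrixP/(_ i j) := GW; rewrite -mulmxA DC mulmxA !mul_mx_diag.
  by rewrite [LHS]mxE [RHS]mxE.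
rewrite -[LHS]mulmx1 -WW mulmxA -(mulmxA _ N^T W) -CE -(mulmxA N) eC mulmxA.
by rewrite NCg.
Qed.
End Perturbation.

(** * Positive definite matrices and the Nyström approximation *)

Section PosDef.
Variable R : realType.

Lemma mulmx1_invmx n (A B : 'M[R]_n) : A *m B = 1%:M -> invmx A = B.
Proof.
by move=> AB; have [uA _] := mulmx1_unit AB; rewrite -[LHS]mulmx1 -AB mulKmx.
Qed.

Lemma invmxM n (A B : 'M[R]_n) : A \in unitmx -> B \in unitmx ->
  invmx (A *m B) = invmx B *m invmx A.
Proof.
by move=> uA uB; apply: mulmx1_invmx; rewrite mulmxA mulmxK// mulmxV.
Qed.

Lemma invmx_diag_orth n (Q : 'M[R]_n) (d : 'rV[R]_n) :
  Q *m Q^T = 1%:M -> (forall i, d 0 i != 0) ->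
  invmx (Q *m diag_mx d *m Q^T)
    = Q *m diag_mx (map_mx (fun x => x^-1) d) *m Q^T.
Proof.
move=> QQ d0; apply: mulmx1_invmx.
rewrite !mulmxA -(mulmxA _ Q^T Q) (mulmx1C QQ) mulmx1.
rewrite -(mulmxA Q) mulmx_diag (_ : diag_mx _ = 1%:M) ?mulmx1//.
by rewrite -diag_const_mx; congr diag_mx; apply/rowP => i; rewrite !mxE mulfV.
Qed.

Lemma quad_diag n (d : 'rV[R]_n) (w : 'cV[R]_n) :
  (w^T *m diag_mx d *m w) 0 0 = \sum_i d 0 i * w i 0 ^+ 2.
Proof.
rewrite mul_mx_diag mxE; apply: eq_bigr => i _.
by rewrite !mxE mulrAC mulrC expr2.
Qed.

Lemma posdefmx_diag_orth n (Q : 'M[R]_n) (d : 'rV[R]_n) :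
  Q *m Q^T = 1%:M -> (forall i, 0 < d 0 i) -> posdefmx (Q *m diag_mx d *m Q^T).
Proof.
move=> QQ d0; split; first by rewrite !trmx_mul trmxK tr_diag_mx mulmxA.
move=> x x0; pose w := Q^T *m x.
have -> : x^T *m (Q *m diag_mx d *m Q^T) *m x = w^T *m diag_mx d *m w.
  by rewrite /w trmx_mul trmxK !mulmxA.
have w0 : w != 0.
  apply: contraNneq x0 => w0.
  by rewrite -[x]mul1mx -QQ -mulmxA -/w w0 mulmx0.
have dw i : 0 <= d 0 i * w i 0 ^+ 2 by rewrite mulr_ge0 ?sqr_ge0 ?ltW.
rewrite quad_diag lt_neqAle sumr_ge0// andbT eq_sym psumr_eq0//.
apply: contraNN w0 => /allP h; apply/eqP/colP => i; rewrite [RHS]mxE.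
have := h i (mem_index_enum _); rewrite /= mulf_eq0 gt_eqF//= sqrf_eq0.
by move/eqP.
Qed.

Lemma posdefmx_spectral n (A : 'M[R]_n) : posdefmx A ->
  exists (Q : 'M[R]_n) (d : 'rV[R]_n),
  [/\ Q *m Q^T = 1%:M, A = Q *m diag_mx d *m Q^T & forall i, 0 < d 0 i].
Proof.
move=> [sA pA]; have [Q [d [QQ e]]] := sym_spectral sA.
exists Q, d; split => // i; pose u : 'cV[R]_n := delta_mx i 0.
have u0 : u != 0.
  by apply/eqP => /colP/(_ i); rewrite !mxE !eqxx => /eqP; rewrite oner_eq0.
have QQu : Q^T *m (Q *m u) = u by rewrite mulmxA (mulmx1C QQ) mul1mx.
have /pA : Q *m u != 0.
  by apply: contraNneq u0 => Qu; rewrite -QQu Qu mulmx0.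
have -> : (Q *m u)^T *m A *m (Q *m u) = u^T *m diag_mx d *m u.
  rewrite e trmx_mul -!mulmxA QQu !mulmxA; congr (_ *m _ *m _).
  by rewrite -mulmxA (mulmx1C QQ) mulmx1.
rewrite quad_diag (bigD1 i)//= big1 => [|j ji].
  by rewrite mxE !eqxx expr1n mulr1 addr0.
by rewrite mxE (negbTE ji) expr0n mulr0.
Qed.

Lemma posdefmx_unit n (A : 'M[R]_n) : posdefmx A -> A \in unitmx.
Proof.
move=> [sA pA]; rewrite unitmxE unitfE; apply/negP => /det0P[v v0 vA].
have := pA v^T; rewrite trmx_eq0 => /(_ v0).
by rewrite trmxK vA mul0mx mxE ltxx.
Qed.

Lemma posdefmx_inv n (A : 'M[R]_n) : posdefmx A -> posdefmx (invmx A).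
Proof.
move=> /posdefmx_spectral[Q [d [QQ -> d0]]].
rewrite invmx_diag_orth// => [|i]; last exact: lt0r_neq0.
by apply: posdefmx_diag_orth => // i; rewrite mxE invr_gt0.
Qed.

Lemma posdefmx_conj m n (A : 'M[R]_m) (S : 'M[R]_(m, n)) (T : 'M[R]_(n, m)) :
  posdefmx A -> T *m S = 1%:M -> posdefmx (S^T *m A *m S).
Proof.
move=> [sA pA] TS; split; first by rewrite !trmx_mul trmxK sA mulmxA.
move=> x x0; have /pA : S *m x != 0.
  by apply: contraNneq x0 => Sx0; rewrite -[x]mul1mx -TS -mulmxA Sx0 mulmx0.
by rewrite trmx_mul !mulmxA.
Qed.

Lemma invsqrtmxP n (A : 'M[R]_n) : posdefmx A ->
  posdefmx (invsqrtmx A) /\ invsqrtmx A *m invsqrtmx A = invmx A.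
Proof.
move=> pA; apply: (@xgetPex _ 0
  [set B : 'M[R]_n | posdefmx B /\ B *m B = invmx A]%classic).
have [Q [d [QQ -> d0]]] := posdefmx_spectral pA.
exists (Q *m diag_mx (map_mx (fun x => (Num.sqrt x)^-1) d) *m Q^T); split => /=.
  by apply: posdefmx_diag_orth => // i; rewrite mxE invr_gt0 sqrtr_gt0.
rewrite invmx_diag_orth => // [|i]; last exact: lt0r_neq0.
rewrite !mulmxA -(mulmxA _ Q^T Q) (mulmx1C QQ) mulmx1 -(mulmxA Q) mulmx_diag.
congr (_ *m diag_mx _ *m _); apply/rowP => i; rewrite !mxE.
by rewrite -invfM -expr2 sqr_sqrtr// ltW.
Qed.
End PosDef.

(** Since [V = K *m S *m B] with [B] invertible, [V^T *m L *m V] equals [B *m (S^T *m K *m S) *m B].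
    In [V (V^T L V)^-1 V^T] the factors [B] cancel, leaving the Nyström approximation. An eigenbasis
    [Y] of [V^T *m L *m V] thus diagonalises both matrices through [N = V *m Y]. *)
Lemma nystrom_spectral (R : realType) (n : nat) (L : 'M[R]_n) (I : {set 'I_n})
    (t : R) :
  posdefmx L ->
  let K := invmx L in
  let V := orthmx (cols_of I K) in
  exists (N : 'M[R]_(n, #|I|)) (m : 'rV[R]_#|I|),
  [/\ N^T *m N = 1%:M, forall i, 0 < m 0 i,
      K - nystrom_residual I K
        = N *m diag_mx (map_mx (fun x => x^-1) m) *m N^T
    & V *m expmx (- t *: (V^T *m L *m V)) *m V^T
        = N *m diag_mx (map_mx (fun x => expR (- t * x)) m) *m N^T].
Proof.
move=> pL K V.
have pK : posdefmx K by exact: posdefmx_inv.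
have KT : K^T = K by case: pK.
have LK : L *m K = 1%:M by rewrite mulmxV// posdefmx_unit.
(* Column selection as multiplication by [S] turns every submatrix of [K] into a matrix product. *)
pose S : 'M[R]_(n, #|I|) := colsub (fun k : 'I_#|I| => enum_val k) 1%:M.
have SS : S^T *m S = 1%:M.
  apply/matrixP => i j; rewrite !mxE (bigD1 (enum_val i))//= big1 ?addr0.
    by rewrite !mxE eqxx mul1r (inj_eq enum_val_inj).
  by move=> k ki; rewrite !mxE (negbTE ki) mul0r.
have cE : cols_of I K = K *m S by rewrite /S mulmx_colsub mulmx1.
have rE : rows_of I K = S^T *m K.
  rewrite -[RHS]trmxK trmx_mul trmxK KT -cE.
  by apply/matrixP => i j; rewrite !mxE -[in LHS]KT mxE.
pose KI := S^T *m K *m S.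
have pE : principal_submx I K = KI.
  rewrite /KI -rE; apply/matrixP => i j.
  rewrite [RHS]mxE (bigD1 (enum_val j))//= big1 ?addr0.
    by rewrite !mxE eqxx mulr1.
  by move=> k kj; rewrite !mxE (negbTE kj) mulr0.
have pKI : posdefmx KI by exact: posdefmx_conj SS.
pose A := K *m S; pose B := invsqrtmx (A^T *m A).
have pAA : posdefmx (A^T *m A).
  have p1 : posdefmx (1%:M : 'M[R]_n).
    split; first exact: trmx1.
    by move=> x x0; rewrite mulmx1; exact: dotmx_gt0.
  rewrite -[A^T]mulmx1; apply: (posdefmx_conj (T := S^T *m L)) => //.
  by rewrite /A mulmxA -(mulmxA _ L) LK mulmx1.
have [[BT _] BB] := invsqrtmxP pAA; rewrite -/B in BT BB.
have VE : V = A *m B by rewrite /V /orthmx cE.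
(* One factor [B] passes from left to right because a one-sided inverse of a square matrix is
   two-sided. *)
have BAB : B *m (A^T *m A) *m B = 1%:M.
  have : B *m (B *m (A^T *m A)) = 1%:M.
    by rewrite mulmxA BB mulVmx// posdefmx_unit.
  exact: mulmx1C.
have uB : B \in unitmx by have [] := mulmx1_unit BAB.
have VV : V^T *m V = 1%:M by rewrite VE trmx_mul BT mulmxA -(mulmxA B) BAB.
have LV : V^T *m L *m V = B^T *m KI *m B.
  by rewrite VE /A /KI !trmx_mul KT !mulmxA -(mulmxA _ L) LK mulmx1.
have pLV : posdefmx (V^T *m L *m V).
  by rewrite LV; apply: (posdefmx_conj (T := invmx B)) => //; rewrite mulVmx.
have [Y [m [YY eY m0]]] := posdefmx_spectral pLV.
exists (V *m Y), m; split => //.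
- by rewrite trmx_mul mulmxA -(mulmxA _ _ V) VV mulmx1 (mulmx1C YY).
- rewrite /nystrom_residual opprB addrC subrK cE rE pE trmx_mul.
  have -> : V *m Y *m diag_mx (map_mx (fun x => x^-1) m) *m (Y^T *m V^T)
      = V *m invmx (V^T *m L *m V) *m V^T.
    by rewrite eY invmx_diag_orth ?mulmxA// => i; rewrite lt0r_neq0.
  rewrite LV BT !invmxM ?unitmx_mul ?uB ?posdefmx_unit// VE trmx_mul BT.
  rewrite !mulmxA mulmxK// mulmxKV//.
  by rewrite /A trmx_mul KT !mulmxA.
- have -> : - t *: (V^T *m L *m V)
      = Y *m diag_mx (map_mx (fun x => - t * x) m) *m Y^T.
    rewrite eY scalemxAl scalemxAr; congr (_ *m _ *m _).
    by apply/matrixP => i j; rewrite !mxE mulrnAr.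
  rewrite expmx_diag_orth// (trmx_mul V Y) !mulmxA.
  congr (_ *m diag_mx _ *m _ *m _).
  by apply/rowP => i; rewrite !mxE.
Qed.

Theorem theorem1 (R : realType) (n : nat) (L : 'M[R]_n) (I : {set 'I_n}) (t : R) :
  posdefmx L -> I != finset.set0 -> 0 < t ->
  let K := invmx L in
  let P := expmx (- t *: L) in
  let V := orthmx (cols_of I K) in
  let PI := V *m expmx (- t *: (V^T *m L *m V)) *m V^T in
  let E := nystrom_residual I K in
  spectral_norm (P - PI)
    <= 3 * Num.sqrt 3 / (2 * pi) * (spectral_norm E / t)
  /\
  nuclear_norm (P - PI)
    <= 3 * Num.sqrt 3 / (2 * pi) * (nuclear_norm E / t).
Proof.
move=> pL _ t0 K P V PI E.
have [N [m [NN m0 eG ePI]]] := nystrom_spectral I t pL.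
rewrite -/K -/V -/PI -/E in eG ePI.
have [U [d [UU eL d0]]] := posdefmx_spectral pL.
have dn0 i : d 0 i != 0 by exact: lt0r_neq0.
have eK : K = U *m diag_mx (map_mx (fun x => x^-1) d) *m U^T.
  by rewrite /K eL invmx_diag_orth.
have eP : P = U *m diag_mx (map_mx (fun x => expNV (x / t))
    (map_mx (fun x => x^-1) d)) *m U^T.
  rewrite /P eL scalemxAl scalemxAr.
  have -> : - t *: diag_mx d = diag_mx (map_mx (fun x => - t * x) d).
    by apply/matrixP => i j; rewrite !mxE mulrnAr.
  rewrite expmx_diag_orth//; congr (_ *m diag_mx _ *m _); apply/rowP => i.
  rewrite !mxE /expNV mulf_eq0 !invr_eq0 (negbTE (dn0 i)) gt_eqF//=.
  by rewrite mulNr invfM !invrK [in RHS]mulrC.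
have GT : (K - E)^T = K - E.
  by rewrite eG !trmx_mul trmxK tr_diag_mx mulmxA.
(* The perturbation bound compares two square eigenbases, whereas [N] has only [#|I|] columns; hence
   a full eigenbasis of the Nyström matrix [K - E]. *)
have [W [nu [WW eW]]] := sym_spectral GT.
have [nu0 ePI'] := galerkin_spectral NN m0 WW t0 (etrans (esym eG) eW).
have d'0 i : 0 <= map_mx (fun x => x^-1) d 0 i by rewrite mxE invr_ge0 ltW.
have := perturbation_norm_le UU WW d'0 nu0 t0.
rewrite -ePI' -ePI -eP -eK -eW subKr => -[h2 h1].
set c := 3 * Num.sqrt 3 / (2 * pi).
have cge := sqrt3_pi_ge R; rewrite -/c in cge.
have le (x y : R) : 0 <= y ->
    x <= (46 / 100 + (59 / 100) ^+ 2) / t * y -> x <= c * (y / t).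
  move=> y0 /le_trans; apply.
  rewrite mulrAC mulrA ler_wpM2r ?invr_ge0 ?(ltW t0)//.
  exact: ler_wpM2r.
split; apply: le => //.
  exact: bigmax_ge_id.
exact: nuclear_norm_ge0.
Qed.
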